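(* Let $I$ be a monomial ideal in a polynomial ring $R$ over a field and suppose that for every variable $x\in R$ we have $d_x(M)=d_x(I)$ for every monomial $M\in\mathcal{G}(I)$ such that $x\mid M$. Then $R/I$ has no embedded associated primes. Furthermore, $\operatorname{Min}(R/I)=\operatorname{Min}(R/J)$, where $J=\langle\widetilde{M}\mid M\in\mathcal{G}(I)\rangle$.
   Context: For a monomial ideal $I$, $\mathcal{G}(I)$ denotes its set of (minimal) monomial generators. For a variable $x$ and a monomial $M$, $d_x(M)$ is the degree of $x$ in $M$, and $d_x(I)=\max\{d_x(M)\mid M\in\mathcal{G}(I)\}$. For a monomial $M$, $\widetilde{M}$ denotes its squarefree part, i.e. the product of the distinct variables dividing $M$. $\operatorname{Min}(R/I)$ is the set of minimal associated primes of $R/I$; an associated prime is embedded if it is not minimal. *)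

(* Defs.v *)
From HB Require Import structures.
From mathcomp Require Import all_boot all_order all_algebra.
From mathcomp.multinomials Require Import mpoly.
From Stdlib Require Import Classical.

Set Implicit Arguments.
Unset Strict Implicit.
Unset Printing Implicit Defensive.

Import GRing.Theory.
Local Open Scope ring_scope.

(* Subsets of a ring are arbitrary Prop-valued predicates, compared
   extensionally: membership in an ideal is not assumed to be decidable. *)

Section Ideals.
Context {A : comNzRingType}.
Implicit Types I P Q S : A -> Prop.

Definition subideal P Q : Prop := forall a, P a -> Q a.

Definition is_ideal I : Prop :=
  [/\ I 0, forall a b, I a -> I b -> I (a + b) & forall r a, I a -> I (r * a)].

Definition gen_ideal S : A -> Prop :=
  fun a => forall I, is_ideal I -> subideal S I -> I a.

Definition is_prime P : Prop :=
  [/\ is_ideal P, ~ P 1 & forall a b, P (a * b) -> P a \/ P b].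

(* Annihilator of the class of f in A/I: the class of a * f is 0 in A/I
   exactly when a * f lies in I. *)
Definition ann_class I (f : A) : A -> Prop := fun a => I (a * f).

Definition is_assoc I P : Prop :=
  is_prime P /\ exists f, forall a, P a <-> ann_class I f a.

Definition is_min_assoc I P : Prop :=
  is_assoc I P /\ forall Q, is_assoc I Q -> subideal Q P -> subideal P Q.

Definition is_embedded I P : Prop := is_assoc I P /\ ~ is_min_assoc I P.

End Ideals.

Section MonomialIdeals.
Context {K : fieldType} {n : nat}.
Implicit Types (I : {mpoly K[n]} -> Prop) (S G : 'X_{1..n} -> Prop).
Implicit Types m : 'X_{1..n}.

(* A monomial is represented by its exponent vector m : 'X_{1..n}, so that
   d_x(M) is m i for x = 'X_i and divisibility is (_ <= _)%MM. *)

Definition mono_gen S : {mpoly K[n]} -> Prop :=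
  gen_ideal (fun p => exists2 m, S m & p = 'X_[m]).

Definition generates S I : Prop := forall p, I p <-> mono_gen S p.

Definition is_monomial_ideal I : Prop := exists S, generates S I.

Definition min_generating_set I G : Prop :=
  generates G I /\
  forall S, (forall m, S m -> G m) -> generates S I -> forall m, G m -> S m.

(* G(I). A monomial ideal has exactly one minimal generating set of monomials;
   see min_gensP and min_generating_set_min_gens below. *)
Definition min_gens I : 'X_{1..n} -> Prop :=
  fun m => exists2 G, min_generating_set I G & G m.

(* d = d_x(I) for x = 'X_i. This is a relation because the maximum does not
   exist when G(I) is empty, that is, when I = 0. *)
Definition is_max_deg I (i : 'I_n) (d : nat) : Prop :=
  (exists2 m, min_gens I m & m i = d) /\
  (forall m, min_gens I m -> (m i <= d)%N).

Definition sqfree_part (m : 'X_{1..n}) : 'X_{1..n} :=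
  (\sum_(i < n | (0 < m i)%N) U_(i))%MM.

Definition sqfree_ideal I : {mpoly K[n]} -> Prop :=
  mono_gen (fun m' => exists2 m, min_gens I m & m' = sqfree_part m).

Lemma gen_ideal_is_ideal (A : comNzRingType) (T : A -> Prop) :
  is_ideal (gen_ideal T).
Proof.
split=> [J [J0 _ _] _ //|a b ha hb J hJ sTJ|r a ha J hJ sTJ].
  by case: (hJ) => _ hD _; apply: hD; [apply: ha | apply: hb].
by case: (hJ) => _ _ hM; apply: hM; apply: ha.
Qed.

Lemma mono_genP S (p : {mpoly K[n]}) :
  mono_gen S p <->
  (forall m, m \in msupp p -> exists2 m', S m' & (m' <= m)%MM).
Proof.
split=> [hp|hp].
  apply: (hp (fun q : {mpoly K[n]} =>
    forall m, m \in msupp q -> exists2 m', S m' & (m' <= m)%MM)).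
    split=> [m|a b ha hb m /msuppD_le|r a ha m /msuppM_le].
    - by rewrite msupp0.
    - by rewrite mem_cat => /orP[/ha|/hb].
    - case/allpairsP=> -[m1 m2] /= [_ /ha [m' Sm' le_m'] ->].
      by exists m' => //; apply: lepm_trans le_m' (lem_addl _ _).
  move=> _ [m Sm ->] m'; rewrite msuppX inE => /eqP->.
  by exists m => //; exact: lepm_refl.
have [J0 JD JM] := gen_ideal_is_ideal
  (fun p : {mpoly K[n]} => exists2 m, S m & p = 'X_[m]).
rewrite (mpolyE p) big_seq; apply: (big_ind (mono_gen S)) => // m /hp [m' Sm' le].
rewrite -(submK le) mpolyXD scalerAl; apply: JM.
by move=> J _; apply; exists m'.
Qed.

Lemma mono_genXP S m :
  mono_gen S 'X_[K, m] <-> exists2 m', S m' & (m' <= m)%MM.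
Proof.
rewrite mono_genP msuppX; split=> [|h m']; first by apply; rewrite inE.
by rewrite inE => /eqP->.
Qed.

Definition div_minimal I m : Prop :=
  I 'X_[m] /\ forall m', I 'X_[m'] -> (m' <= m)%MM -> m' = m.

Lemma lepm_anti m m' : (m <= m')%MM -> (m' <= m)%MM -> m = m'.
Proof.
move=> /mnm_lepP h /mnm_lepP h'.
by apply/mnmP=> i; apply/eqP; rewrite eqn_leq h h'.
Qed.

Lemma div_minimal_below I m :
  I 'X_[m] -> exists2 m', div_minimal I m' & (m' <= m)%MM.
Proof.
have [k] := ubnP (mdeg m); elim: k m => // k IHk m ltk Im.
have [minm|] := classic (div_minimal I m).
  by exists m => //; exact: lepm_refl.
move=> notmin; have [m' [Im' le_m' ne_m']] :
    exists m', [/\ I 'X_[m'], (m' <= m)%MM & m' <> m].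
  apply: NNPP => no; apply: notmin; split=> // m' Im' le_m'.
  by apply: NNPP => ne; apply: no; exists m'.
have lt_m' : (mdeg m' < mdeg m)%N.
  rewrite -(submK le_m') mdegD -[X in (X < _)%N]add0n ltn_add2r lt0n mdeg_eq0.
  by apply/eqP=> e; apply: ne_m'; rewrite -(submK le_m') e add0m.
have [m2 ? le2] := IHk m' (leq_trans lt_m' ltk) Im'.
by exists m2 => //; exact: lepm_trans le2 le_m'.
Qed.

Lemma min_generating_set_div_minimal I :
  is_monomial_ideal I -> min_generating_set I (div_minimal I).
Proof.
move=> [S genS]; split=> [p|T subT genT m [Im minm]].
  rewrite genS !mono_genP; split=> hp m /hp [m' hm' le].
    have Im' : I 'X_[m'].
      by apply/genS/mono_genXP; exists m' => //; exact: lepm_refl.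
    have [m2 ? le2] := div_minimal_below Im'.
    by exists m2 => //; exact: lepm_trans le2 le.
  have [Im' _] := hm'; move/genS/mono_genXP: Im' => [m2 ? le2].
  by exists m2 => //; exact: lepm_trans le2 le.
have /genT/mono_genXP [m' Tm' le] := Im.
by rewrite -(minm m') //; case: (subT _ Tm').
Qed.

Lemma min_generating_set_sub I G m :
  min_generating_set I G -> G m -> div_minimal I m.
Proof.
move=> [genG minG] Gm; split=> [|m' /genG/mono_genXP [g Gg le_g] le].
  by apply/genG/mono_genXP; exists m => //; exact: lepm_refl.
have [eg|/eqP neg] := eqVneq g m.
  by apply: lepm_anti => //; rewrite -eg.
case: (minG (fun x => G x /\ x <> m) _ _ m Gm) => [x []|p|_] //.
rewrite genG !mono_genP; split=> hp x /hp [y hy ley]; last first.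
  by case: hy => ? _; exists y.
have [ey|/eqP ney] := eqVneq y m; last by exists y.
exists g => //; apply: lepm_trans le_g (lepm_trans le _).
by rewrite -ey.
Qed.

Lemma min_gensP I m :
  is_monomial_ideal I -> (min_gens I m <-> div_minimal I m).
Proof.
move=> monI; split=> [[G minG Gm]|hm]; first exact: min_generating_set_sub Gm.
by exists (div_minimal I) => //; exact: min_generating_set_div_minimal.
Qed.

Lemma min_generating_set_min_gens I G :
  is_monomial_ideal I ->
  (min_generating_set I G <-> forall m, G m <-> min_gens I m).
Proof.
move=> monI; have [genD minD] := min_generating_set_div_minimal monI.
split=> [minG m|eqG].
  split=> [Gm|/(min_gensP _ monI) hm]; first by exists G.
  apply: (minD G) => // [m' Gm'|]; first exact: min_generating_set_sub Gm'.
  by case: minG.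
have eqD m : G m <-> div_minimal I m.
  by rewrite eqG; apply: min_gensP.
split=> [p|S subS genS m /eqD]; last first.
  by apply: minD => // x /subS/eqD.
by rewrite genD !mono_genP; split=> hp m /hp [m' /eqD ? ?]; exists m'.
Qed.

End MonomialIdeals.

(* Main.v *)
Require Import Defs.
From mathcomp Require Import all_boot all_order all_algebra.
From mathcomp.multinomials Require Import mpoly.
From Stdlib Require Import Classical.

(** The hypothesis says that there are exponents e_i > 0 such that every
    minimal generator is a product of some of the powers x_i ^ e_i
    ([equidegree_of_max_deg]). For such an ideal the associated primes can be
    listed: they are exactly the ideals P_C generated by the variables in C,
    where C runs over the minimal vertex covers of the supports of the
    generators ([is_assocP]).

    If C is a minimal cover, P_C is the annihilator of the monomial with
    exponent e_i - 1 on C and e_i elsewhere ([min_cover_assoc]).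

    Conversely let P be prime, equal to the annihilator of the class of f, and
    let C be the set of variables in P ([assoc_min_cover]). The prime P contains
    the ideal I, so every generator has a variable in P: C is a cover. Each
    variable x_i of C kills f modulo I, so multiplying a monomial a of f that is not in I
    by x_i brings it into I. The generator responsible has exponent e_i in x_i,
    which forces a_i = e_i - 1. As this holds for every i in C, the exponents
    of the generator in the other variables x_j of C are below e_j, hence 0:
    the generator meets C in i only, and C is minimal. Moreover the part of f
    outside I has constant exponents e_i - 1 on C. Multiplying it by a nonzero
    polynomial free of the variables of C leaves these exponents unchanged, and
    so does not lead into I; hence P = P_C.

    The list depends on the supports only. Minimal covers form an antichain, so
    no P_C strictly contains another: every associated prime is minimal. The
    squarefree parts have the same supports and satisfy the hypothesis with all
    e_i = 1, so they give the same primes. *)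

Import GRing.Theory.
Local Open Scope ring_scope.

Set Implicit Arguments.
Unset Strict Implicit.
Unset Printing Implicit Defensive.

(** * Cancelling a summand modulo an ideal *)

Lemma ideal_addKr {A : comNzRingType} (J : A -> Prop) a b :
  is_ideal J -> J b -> J (a + b) -> J a.
Proof.
move=> [_ JD JM] Jb Jab.
by rewrite -[a](addrK b) -[- b]mulN1r; apply: JD => //; apply: JM.
Qed.

Section Assoc.
Context {K : fieldType} {n : nat}.
Implicit Types (p q f : {mpoly K[n]}) (m a b : 'X_{1..n}).
Implicit Types (S : 'X_{1..n} -> Prop) (I P : {mpoly K[n]} -> Prop).
Implicit Types (C D : {set 'I_n}) (e : 'I_n -> nat).

(** * Splitting polynomials by their monomials *)

Lemma msupp_split (B : pred 'X_{1..n}) p :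
  exists p0 p1, [/\ p = p0 + p1,
    forall m, m \in msupp p0 -> (m \in msupp p) /\ B m &
    forall m, m \in msupp p1 -> (m \in msupp p) /\ ~~ B m].
Proof.
pose part (B' : pred 'X_{1..n}) := \sum_(m <- msupp p | B' m) p@_m *: 'X_[K, m].
have part_supp B' m : m \in msupp (part B') -> (m \in msupp p) /\ B' m.
  move=> /msupp_sum_le /flattenP /= [s /mapP [m']].
  rewrite mem_filter => /andP [Bm' pm'] -> /msuppZ_le.
  by rewrite msuppX inE => /eqP ->.
exists (part B), (part (predC B)); split; try exact: part_supp.
by rewrite {1}[p]mpolyE (bigID B).
Qed.

(** Every monomial of a product is a product of monomials of the factors, so a
    product lying in a monomial ideal that contains none of the latter has no
    monomials at all; then one factor vanishes because the polynomial ring is a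
    domain. Both the primality of [var_ideal] and the identification of an
    associated prime rest on this. *)
Lemma mul_eq0_of_notin_mono_gen S p q :
  mono_gen S (p * q) ->
  (forall a b, a \in msupp p -> b \in msupp q ->
     forall m, S m -> ~ (m <= a + b)%MM) ->
  p = 0 \/ q = 0.
Proof.
move=> /mono_genP Spq out.
suff /eqP : p * q = 0 by rewrite mulf_eq0 => /orP [] /eqP; [left | right].
apply/eqP; rewrite -msupp_eq0; case E: (msupp (p * q)) => [//|m s].
have pqm : m \in msupp (p * q) by rewrite E inE eqxx.
have [m' Sm' le] := Spq m pqm.
have /allpairsP [[a b] /= [pa qb eqm]] := msuppM_le pqm.
by case: (out a b pa qb m' Sm'); rewrite -eqm.
Qed.

Lemma mono_gen_mulX S p b :
  mono_gen S (p * 'X_[b]) <->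
  forall a, a \in msupp p -> exists2 m, S m & (m <= b + a)%MM.
Proof.
rewrite mono_genP; split=> h a.
  move=> pa; apply: h.
  by rewrite (perm_mem (msuppMX p b)); apply/mapP; exists a.
by rewrite (perm_mem (msuppMX p b)) => /mapP [a' pa' ->]; apply: h.
Qed.

(** * Ideals generated by variables *)

Definition var_ideal C : {mpoly K[n]} -> Prop :=
  mono_gen (fun m => exists2 i, i \in C & m = U_(i)%MM).

Lemma lem1E i m : (U_(i) <= m)%MM = (0 < m i)%N.
Proof.
apply/mnm_lepP/idP => [/(_ i)|mi j]; first by rewrite mnm1E eqxx.
by rewrite mnm1E; case: eqP => // <-.
Qed.

Lemma var_idealP C p :
  var_ideal C p <->
  forall m, m \in msupp p -> exists2 i, i \in C & (0 < m i)%N.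
Proof.
rewrite /var_ideal mono_genP; split=> h m /h [] => [_ [i Ci ->]|i Ci].
  by rewrite lem1E; exists i.
by rewrite -lem1E; exists U_(i)%MM => //; exists i.
Qed.

Lemma var_idealX C i : var_ideal C 'X_i <-> i \in C.
Proof.
rewrite var_idealP msuppX; split=> [/(_ U_(i)%MM)|Ci m].
  rewrite inE eqxx => /(_ isT) [j Cj].
  by rewrite mnm1E; case: eqP => // ->.
by rewrite inE => /eqP ->; exists i => //; rewrite mnm1E eqxx.
Qed.

Lemma var_ideal_split C p :
  exists p0 p1, [/\ p = p0 + p1, var_ideal C p1 &
    forall m, m \in msupp p0 -> forall i, i \in C -> m i = 0%N].
Proof.
have [p0 [p1 [-> h0 h1]]] :=
  msupp_split (fun m => [forall (i | i \in C), m i == 0%N]) p.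
exists p0, p1; split=> // [|m /h0 [_ /forall_inP h] i /h /eqP //].
apply/var_idealP=> m /h1 [_]; rewrite negb_forall_in => /exists_inP [i Ci].
by rewrite -lt0n; exists i.
Qed.

Lemma var_ideal_is_ideal C : is_ideal (var_ideal C).
Proof. exact: gen_ideal_is_ideal. Qed.

(** Modulo the ideal both factors may be replaced by their parts free of the
    variables in C, and the product of these parts is free of them too. *)
Lemma var_ideal_prime C : is_prime (var_ideal C).
Proof.
have idC := var_ideal_is_ideal C; have [J0 JD JM] := idC.
split=> // [|p q].
  by rewrite var_idealP msupp1 => /(_ 0%MM (mem_head _ _)) [i _]; rewrite mnm0E.
have [p0 [p1 [-> Jp1 hp0]]] := var_ideal_split C p.
have [q0 [q1 [-> Jq1 hq0]]] := var_ideal_split C q.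
rewrite mulrDr mulrDl -addrA => Jpq.
have {}Jpq : var_ideal C (p0 * q0).
  apply: ideal_addKr idC _ Jpq; apply: JD; last exact: JM.
  by rewrite mulrC; apply: JM.
case: (mul_eq0_of_notin_mono_gen Jpq) => [a b pa qb m [i Ci ->]|->|->].
- by rewrite lem1E mnmDE (hp0 a) ?(hq0 b).
- by left; rewrite add0r.
- by right; rewrite add0r.
Qed.

Lemma prime_mono P m : is_prime P -> P 'X_[m] -> exists2 i, (0 < m i)%N & P 'X_i.
Proof.
move=> [_ nP1 Pprime].
have [k] := ubnP (mdeg m); elim: k m => // k IHk m ltk Pm.
case: (pickP (fun i => 0 < m i)%N) => [i mi|m0]; last first.
  case: nP1; rewrite -mpolyX0; suff <- : m = 0%MM by [].
  by apply/mnmP=> i; rewrite mnm0E; apply/eqP; rewrite -leqn0 leqNgt m0.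
have le : (U_(i) <= m)%MM by rewrite lem1E.
have {Pm} /Pprime [Pm|Pi] : P ('X_[m - U_(i)] * 'X_i); last by exists i.
  by rewrite -mpolyXD submK.
have ltm : (mdeg (m - U_(i)) < k)%N.
  rewrite -ltnS; apply: leq_trans ltk.
  by rewrite -{2}(submK le) mdegD mdeg1 addn1.
have [j mj Pj] := IHk _ ltm Pm; exists j => //.
by apply: leq_trans mj _; rewrite mnmBE leq_subr.
Qed.

(** * Minimal vertex covers *)

Definition equidegree e S : Prop :=
  (forall i, (0 < e i)%N) /\
  (forall m i, S m -> (0 < m i)%N -> m i = e i).

Definition cover S C : Prop :=
  forall m, S m -> exists2 i, i \in C & (0 < m i)%N.

(** Minimality in witness form: a generator that C :\ i misses is one that C
    meets in i only. *)
Definition min_cover S C : Prop :=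
  cover S C /\
  forall i, i \in C ->
    exists2 m, S m & forall j, j \in C -> (0 < m j)%N -> j = i.

Lemma min_cover_sub S C D :
  min_cover S C -> min_cover S D -> C \subset D -> C = D.
Proof.
move=> [covC _] [_ minD] sCD; apply/eqP; rewrite eqEsubset sCD /=.
apply/subsetP=> i /minD [m /covC [j Cj mj] only].
by rewrite -(only j) // (subsetP sCD).
Qed.

(** A generator dividing b would have to meet the cover in some i, where its
    exponent e_i exceeds b_i. *)
Lemma cover_notin e S C b :
  equidegree e S -> cover S C -> (forall i, i \in C -> b i = (e i).-1) ->
  forall m, S m -> ~ (m <= b)%MM.
Proof.
move=> [e0 eS] covC hb m Sm /mnm_lepP le.
have [i Ci mi] := covC m Sm.
by move: (le i); rewrite (eS _ _ Sm mi) hb // leqNgt prednK ?leqnn.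
Qed.

(** * Associated primes *)

Lemma min_cover_assoc e S C :
  equidegree e S -> min_cover S C -> is_assoc (mono_gen S) (var_ideal C).
Proof.
move=> eqd [covC minC]; have [e0 eS] := eqd; split; first exact: var_ideal_prime.
pose b := [multinom (if i \in C then (e i).-1 else e i) | i < n].
exists 'X_[b] => p; rewrite /ann_class mono_gen_mulX var_idealP.
split=> h a pa.
  (* The generator that meets C only in i divides x_i times the witness. *)
  have [i Ci ai] := h a pa; have [m Sm only] := minC i Ci; exists m => //.
  apply/mnm_lepP => j; rewrite mnmDE mnmE.
  have [mj|] := posnP (m j); first by rewrite mj.
  move=> mj; rewrite (eS _ _ Sm mj); case: ifP => [Cj|_]; last exact: leq_addr.
  by rewrite (only j) // -{1}(prednK (e0 i)) -addn1 leq_add2l.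
have [m Sm le] := h a pa; apply: NNPP => no.
apply: (cover_notin eqd covC _ Sm le) => i Ci.
rewrite mnmDE mnmE Ci; case: (posnP (a i)) => [->|ai]; first by rewrite addn0.
by case: no; exists i.
Qed.

(** A monomial a outside the ideal that x_i carries into it is one step short
    of the exponent e_i: the generator m dividing the product but not a
    must exceed a in the variable x_i. *)
Lemma socle_witness e S a i m :
  equidegree e S -> (forall m', S m' -> ~ (m' <= a)%MM) ->
  S m -> (m <= U_(i) + a)%MM ->
  a i = (e i).-1 /\ forall j, j != i -> (m j <= a j)%N.
Proof.
move=> [e0 eS] out Sm /mnm_lepP le.
have le' j : j != i -> (m j <= a j)%N.
  by move=> ne; move: (le j); rewrite mnmDE mnm1E eq_sym (negPf ne).
split=> //; have lt : (a i < m i)%N.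
  rewrite ltnNge; apply/negP => lei; apply: (out m Sm); apply/mnm_lepP => j.
  by have [->//|/le'] := eqVneq j i.
move: (le i); rewrite mnmDE mnm1E eqxx add1n => lei.
have mi : m i = (a i).+1 by apply/eqP; rewrite eqn_leq lei lt.
by rewrite -(eS m i Sm) ?mi.
Qed.

(** A single monomial of f outside the ideal proves the set C of variables in P
    to be a minimal cover; all such monomials together give P = P_C. *)
Lemma assoc_min_cover e S P :
  equidegree e S -> is_assoc (mono_gen S) P ->
  exists2 C, min_cover S C & forall p, P p <-> var_ideal C p.
Proof.
move=> eqd [primeP [f annf]]; have [e0 eS] := eqd.
have [idP nP1 _] := primeP.
have idI : is_ideal (mono_gen S : {mpoly K[n]} -> Prop) by exact: gen_ideal_is_ideal.
have [_ _ IM] := idI.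
have [inC CP] : exists inC : 'I_n -> bool, forall i, inC i <-> P 'X_i.
  apply: (fin_all_exists (P := fun i (b : bool) => b <-> P 'X_i)) => i.
  by have [Pi|nPi] := classic (P 'X_i); [exists true | exists false].
pose C := [set i | inC i].
have {}CP i : i \in C <-> P 'X_i by rewrite inE.
have covC : cover S C.
  move=> m Sm; have /(prime_mono primeP) [i mi /CP Ci] : P 'X_[m].
    apply/annf; rewrite /ann_class mulrC; apply: IM.
    by apply/mono_genXP; exists m => //; exact: lepm_refl.
  by exists i.
(* Variables of C annihilate f modulo the ideal, hence each monomial of f. *)
have step a i : a \in msupp f -> i \in C -> exists2 m, S m & (m <= U_(i) + a)%MM.
  by move=> fa /CP /annf; rewrite /ann_class mulrC => /mono_gen_mulX; apply.
have [a fa outa] : exists2 a, a \in msupp f & forall m, S m -> ~ (m <= a)%MM.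
  apply: NNPP => no; apply: nP1; apply/annf; rewrite /ann_class mul1r.
  apply/mono_genP=> a fa; apply: NNPP => no'; apply: no; exists a => // m Sm le.
  by apply: no'; exists m.
exists C.
  split=> // i Ci; have [m Sm le] := step a i fa Ci.
  have [_ le'] := socle_witness eqd outa Sm le.
  exists m => // j Cj mj; apply/eqP/negPn/negP => /le'.
  have [m2 Sm2 le2] := step a j fa Cj.
  have [-> _] := socle_witness eqd outa Sm2 le2.
  by rewrite (eS _ _ Sm mj) leqNgt prednK ?leqnn.
have var_sub p : var_ideal C p -> P p.
  by move=> Cp; apply: Cp => // _ [_ [i Ci ->] ->]; apply/CP.
move=> p; split=> [|/var_sub //].
have [p0 [p1 [-> Cp1 hp0]]] := var_ideal_split C p.
move=> Pp; have Pp0 : P p0 by exact: ideal_addKr idP (var_sub _ Cp1) Pp.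
(* f0 collects the monomials of f outside the ideal: by [socle_witness] those
   have exponents e_i - 1 on C. *)
have [f0 [f1 [ef hf0 hf1]]] :=
  msupp_split (fun a => [forall (i | i \in C), a i == (e i).-1]) f.
have If1 : mono_gen S f1.
  apply/mono_genP=> b /hf1 [fb /negP nb]; apply: NNPP => no; apply: nb.
  apply/forall_inP=> i Ci; have [m Sm le] := step b i fb Ci.
  have outb m' : S m' -> ~ (m' <= b)%MM by move=> Sm' le'; apply: no; exists m'.
  by have [-> _] := socle_witness eqd outb Sm le.
have Ip0f0 : mono_gen S (p0 * f0).
  move/annf: Pp0; rewrite /ann_class ef mulrDr; apply: ideal_addKr idI _.
  exact: IM.
case: (mul_eq0_of_notin_mono_gen Ip0f0) => [b c pb fc||f0_0].
- apply: cover_notin eqd covC _ => i Ci.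
  have [_ /forall_inP /(_ i Ci) /eqP] := hf0 c fc.
  by rewrite mnmDE (hp0 b pb).
- by move=> ->; rewrite add0r.
- case: nP1; apply/annf; rewrite /ann_class mul1r ef f0_0 add0r.
  exact: If1.
Qed.

(** Ideals are compared extensionally, hence these two transfer lemmas. *)
Lemma is_assoc_ext I J P : (forall p, I p <-> J p) -> is_assoc I P -> is_assoc J P.
Proof.
by move=> IJ [primeP [f annf]]; split=> //; exists f => a; rewrite annf; exact: IJ.
Qed.

Lemma is_assoc_ext_prime I P Q :
  (forall p, P p <-> Q p) -> is_assoc I P -> is_assoc I Q.
Proof.
move=> PQ [[[P0 PD PM] P1 Pprime] [f annf]].
split; last by exists f => a; rewrite -PQ.
split=> [|/PQ //|a b /PQ /Pprime [] /PQ]; [|by left|by right].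
by split=> [|a b /PQ ? /PQ ?|r a /PQ ?]; apply/PQ; auto.
Qed.

Lemma is_assocP e S I P :
  equidegree e S -> generates S I ->
  is_assoc I P <->
  exists2 C, min_cover S C & forall p, P p <-> var_ideal C p.
Proof.
move=> eqd genS; split=> [/(is_assoc_ext genS) /(assoc_min_cover eqd) //|].
move=> [C minC PC].
have IS p : mono_gen S p <-> I p by rewrite genS.
apply: (is_assoc_ext IS); apply: is_assoc_ext_prime (min_cover_assoc eqd minC).
by move=> p; rewrite PC.
Qed.

(** No associated prime contains another one strictly, since minimal covers
    form an antichain. *)
Lemma is_min_assocP e S I P :
  equidegree e S -> generates S I -> is_min_assoc I P <-> is_assoc I P.
Proof.
move=> eqd genS; split=> [[]//|assocP]; split=> // Q.
have /(is_assocP P eqd genS) [C minC PC] := assocP.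
move=> /(is_assocP Q eqd genS) [D minD QD] sQP.
suff eqDC : D = C by move=> p /PC; rewrite -eqDC => /QD.
apply: min_cover_sub minD minC _; apply/subsetP => i.
by move=> /(var_idealX D i) /QD /sQP /PC /(var_idealX C i).
Qed.

(** * Exponents and supports of the minimal generators *)

Lemma equidegree_of_max_deg I :
  (forall i m, min_gens I m -> (0 < m i)%N -> is_max_deg I i (m i)) ->
  exists e, equidegree e (min_gens I).
Proof.
move=> hdeg.
have [e he] : exists e : 'I_n -> nat, forall i,
    (0 < e i)%N /\ forall m, min_gens I m -> (0 < m i)%N -> m i = e i.
  apply: (fin_all_exists (P := fun i (d : nat) =>
    (0 < d)%N /\ forall m, min_gens I m -> (0 < m i)%N -> m i = d)) => i.
  have [[m [Gm mi]]|no] := classic (exists m, min_gens I m /\ (0 < m i)%N).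
    exists (m i); split=> // m' Gm' m'i; apply/eqP; rewrite eqn_leq.
    have [_ -> //] := hdeg i m Gm mi.
    by have [_ -> //] := hdeg i m' Gm' m'i.
  (* No generator involves 'X_i: any positive exponent will do. *)
  by exists 1%N; split=> // m Gm mi; case: no; exists m.
by exists e; split=> [i|m i]; [case: (he i) | case: (he i) => _; apply].
Qed.

Lemma sqfree_partE m i : sqfree_part m i = (0 < m i)%N.
Proof.
rewrite /sqfree_part mnm_sumE.
have [mi|mi] := posnP (m i).
  rewrite big1 // => j mj; rewrite mnm1E; case: eqP => // eji.
  by rewrite eji mi in mj.
rewrite (bigD1 i) //= mnm1E eqxx big1 // => j /andP [_ ne].
by rewrite mnm1E (negPf ne).
Qed.

Lemma sqfree_part_gt0 m i : (0 < sqfree_part m i)%N = (0 < m i)%N.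
Proof. by rewrite sqfree_partE lt0b. Qed.

(** A cover only sees the supports of the generators, and taking squarefree
    parts preserves them. *)
Lemma min_cover_sqfree S C :
  min_cover (fun m' => exists2 m, S m & m' = sqfree_part m) C <-> min_cover S C.
Proof.
split=> -[cov minC]; split.
- move=> m Sm; have [|i Ci] := cov (sqfree_part m); first by exists m.
  by rewrite sqfree_part_gt0; exists i.
- move=> i /minC [_ [m Sm ->] only]; exists m => // j Cj mj.
  by apply: only => //; rewrite sqfree_part_gt0.
- by move=> _ [m /cov [i Ci mi] ->]; exists i; rewrite ?sqfree_part_gt0.
- move=> i /minC [m Sm only]; exists (sqfree_part m); first by exists m.
  by move=> j Cj; rewrite sqfree_part_gt0; apply: only.
Qed.

Lemma equidegree_sqfree S :
  equidegree (fun=> 1%N) (fun m' => exists2 m, S m & m' = sqfree_part m).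
Proof. by split=> // _ i [m _ ->]; rewrite sqfree_partE; case: (0 < m i)%N. Qed.

End Assoc.

Theorem corollary2p13 (K : fieldType) (n : nat) (I : {mpoly K[n]} -> Prop)
    (monI : is_monomial_ideal I)
    (hdeg : forall (i : 'I_n) (m : 'X_{1..n}),
        min_gens I m -> (0 < m i)%N -> is_max_deg I i (m i)) :
  (forall P : {mpoly K[n]} -> Prop, ~ is_embedded I P) /\
  (forall P : {mpoly K[n]} -> Prop,
      is_min_assoc I P <-> is_min_assoc (sqfree_ideal I) P).
Proof.
have [e eqd] := equidegree_of_max_deg hdeg.
have genI : generates (min_gens I) I.
  by have [] := (min_generating_set_min_gens (min_gens I) monI).2 (fun=> iff_refl _).
split=> [P [assocP []]|P]; first exact/(is_min_assocP P eqd genI).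
have eqd1 := equidegree_sqfree (min_gens I).
have genJ : generates _ (sqfree_ideal I) := fun=> iff_refl _.
rewrite (is_min_assocP P eqd genI) (is_min_assocP P eqd1 genJ).
rewrite (is_assocP P eqd genI) (is_assocP P eqd1 genJ).
by split=> -[C minC PC]; exists C => //; apply/min_cover_sqfree.
Qed.
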